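(* Let $\Lambda\subset\mathbb{R}^2$ be an irrational lattice generated by $(1,1)$ and $(-\Delta,-\widetilde\Delta)$ with $\Delta>1$ and $-1<\widetilde\Delta<0$, and let $\mathfrak{A}=(a_i)_{i\in\mathbb{Z}}$ be the associated sequence of positive integers, defined by $\Delta=[a_0,a_1,a_2,\dots]$ and $-\widetilde\Delta=[0,a_{-1},a_{-2},\dots]$. Suppose that $a=\max\mathfrak{A}$ exists. Then $$\mathrm{disp}(\overline{a})\le\frac{\mathrm{disp}(\Lambda)}{\det(\Lambda)}\le\mathrm{disp}(\overline{a,1}).$$
   Context: A lattice in $\mathbb{R}^2$ is irrational if no two of its distinct points lie on the same horizontal or vertical line; $\det(\Lambda)>0$ denotes its covolume. The dispersion $\mathrm{disp}(\Lambda)$ is the supremum of the areas of all open axis-parallel boxes in $\mathbb{R}^2$ that contain no point of $\Lambda$. Square brackets denote continued fractions. For a two-sided sequence $\mathfrak{B}=(b_i)_{i\in\mathbb{Z}}$ of positive integers, its dispersion is $$\mathrm{disp}(\mathfrak{B})=\sup_{i\in\mathbb{Z}}\max_{0\le j<b_i}\frac{(1-j+\Delta_i)(1+j-\widetilde\Delta_i)}{\Delta_i-\widetilde\Delta_i},$$ where $\Delta_i=[b_i,b_{i+1},b_{i+2},\dots]$ and $-\widetilde\Delta_i=[0,b_{i-1},b_{i-2},\dots]$. Here $\overline a$ denotes the constant two-sided sequence with all entries $a$, and $\overline{a,1}$ the two-sided sequence alternating between $a$ and $1$. *)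

(* Defs.v *)
From HB Require Import structures.
From mathcomp Require Import all_boot all_order all_algebra.
From mathcomp Require Import all_classical all_reals all_analysis.
Set Implicit Arguments.
Unset Strict Implicit.
Unset Printing Implicit Defensive.
Import Order.TTheory GRing.Theory Num.Theory.
Import numFieldNormedType.Exports.
Local Open Scope classical_set_scope.
Local Open Scope ring_scope.

Definition lattice_gen (R : realType) (u v : R * R) : set (R * R) :=
  [set p | exists m n : int, p = u *~ m + v *~ n].

Definition det2 (R : realType) (u v : R * R) : R := u.1 * v.2 - u.2 * v.1.

Definition is_lattice (R : realType) (L : set (R * R)) : Prop :=
  exists u v : R * R, det2 u v != 0 /\ L = lattice_gen u v.

(* The covolume: the value of |det (u, v)| at a basis (u, v) of L; all bases
   of a lattice give the same value, so the choice made by xget is immaterial. *)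
Definition covolume (R : realType) (L : set (R * R)) : R :=
  xget 0 [set d | exists u v : R * R,
                    [/\ det2 u v != 0, L = lattice_gen u v & d = `|det2 u v|]].

Definition irrational_lattice (R : realType) (L : set (R * R)) : Prop :=
  is_lattice L /\
  (forall p q : R * R, L p -> L q -> p <> q -> p.1 <> q.1 /\ p.2 <> q.2).

Definition open_box (R : realType) (x1 x2 y1 y2 : R) : set (R * R) :=
  [set p | x1 < p.1 < x2 /\ y1 < p.2 < y2].

(* Bounded boxes suffice: every unbounded box is an increasing union of bounded
   ones, whose areas tend to +oo. *)
Definition disp_lattice (R : realType) (L : set (R * R)) : \bar R :=
  ereal_sup [set A | exists x1 x2 y1 y2 : R,
    [/\ x1 < x2, y1 < y2, open_box x1 x2 y1 y2 `&` L = set0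
      & A = ((x2 - x1) * (y2 - y1))%:E]].

(* The n-th convergent [b 0, b 1, ..., b n]. *)
Fixpoint convergent (R : realType) (b : nat -> nat) (n : nat) : R :=
  if n is n'.+1 then (b 0%N)%:R + (convergent R (fun k => b k.+1) n')^-1
  else (b 0%N)%:R.

Definition cfrac (R : realType) (b : nat -> nat) : R :=
  lim (convergent R b n @[n --> \oo]).

(* [b_i, b_(i+1), b_(i+2), ...] *)
Definition cf_right (R : realType) (b : int -> nat) (i : int) : R :=
  cfrac R (fun k : nat => b (i + k%:Z)).

(* [0, b_(i-1), b_(i-2), ...] *)
Definition cf_left (R : realType) (b : int -> nat) (i : int) : R :=
  cfrac R (fun k : nat => if k is 0%N then 0%N else b (i - k%:Z)).

Definition disp_seq (R : realType) (b : int -> nat) : \bar R :=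
  ereal_sup (range (fun i : int =>
    let D := cf_right R b i in
    let D' := - cf_left R b i in
    \big[maxe/-oo%E]_(j < b i)
      (((1 - j%:R + D) * (1 + j%:R - D')) / (D - D'))%:E)).

Definition const_seq (a : nat) : int -> nat := fun=> a.

Definition alt_seq (a b : nat) : int -> nat :=
  fun i => if odd `|i|%N then b else a.

(* Main.v *)
Require Import Defs.
From HB Require Import structures.
From mathcomp Require Import all_boot all_order all_algebra.
From mathcomp Require Import all_classical all_reals all_analysis.
From mathcomp Require Import ring lra zify.
Import Order.TTheory GRing.Theory Num.Theory.
Import numFieldNormedType.Exports.
Local Open Scope classical_set_scope.
Local Open Scope ring_scope.
Set Implicit Arguments.
Unset Strict Implicit.
Unset Printing Implicit Defensive.

(** Write [x i] for the complete quotient [A i, A (i+1), ...] and [y i] for the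
    reversed one [0, A (i-1), A (i-2), ...].

    Geometry. The continued fraction algorithm, run in both directions, gives
    for every index [i] a basis [(s, t)], [(- x i * s, y i * t)] of the
    lattice; adding [j <= A i] times the first vector to the second one gives
    the basis [(s, t)], [(- u * s, v * t)] with [u = x i - j], [v = y i + j].
    A basis of this shape bounds an empty box of width [|s| * (1 + u)] and
    height [|t| * (1 + v)], and since the covolume is [|s * t| * (u + v)], its
    normalised area is [box_ratio u v = (1 + u) * (1 + v) / (u + v)]
    ([empty_box], [area_le_disp_lattice]). Along the chain of all pairs
    [(i, j)] the widths decrease from infinity to zero, each width
    [|s| * (1 + u)] being followed by [|s| * u]. An empty box has its width
    between two consecutive ones, and then its height is at most
    [|t| * (1 + v)]: the lattice points in a horizontal strip of height
    [|t| * (1 + v)] leave gaps of at most [|s| * u] between their abscissas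
    ([large_box_hits], [empty_box_area_le]). So the normalised dispersion of
    the lattice is the supremum of the numbers [box_ratio u v].

    Upper bound. If [1 <= j < A i] then [u] and [v] exceed [1], where
    [box_ratio] is increasing in both variables, and both fractional parts
    are at most [0, 1, a, 1, a, ...], the values they take at index [0] of the
    alternating sequence ([cf_pair_le_alt]). If [j = 0] then [v <= 1 <= u],
    which forces [box_ratio u v <= 2], and for [a >= 2] the alternating
    sequence already exceeds [2] at [j = 1]. For [a = 1] the sequence [A] is
    constant and nothing has to be compared.

    Lower bound. Let [theta = [0, a, a, ...]] and let [A i = a]. For [a >= 2] only
    the boxes with [j >= 1] of the constant sequence matter, as above. If both
    [x i - a] and [y i] are at least [theta], monotonicity suffices. If
    [x i - a < theta], then [A (i+1) = a] as well, and the tail on the right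
    of [i+1] exceeds [theta]: deviations change sign from one index to the
    next; they expand on the right and contract on the left. So if
    [x i - a] is below and [y i] above [theta] and the excess does not make up
    for the deficit at [i], then it does so at [i+1]
    ([box_ratio_perturb_twice]). The remaining configurations reduce to these
    by a shift of the index by one ([const_ratio_le_some]). *)

(** * Convergence of continued fractions *)

Lemma pow2_unbounded (R : realType) (M : R) : exists n, M < 2 ^+ n.
Proof.
have le_n n : n%:R <= 2 ^+ n :> R.
  by rewrite -natrX ler_nat ltnW // ltn_expl.
exists (Num.truncn M).+1; apply: lt_le_trans (le_n _).
exact: truncnS_gt.
Qed.

Lemma convergent_ge0 (R : realType) (b : nat -> nat) n : 0 <= convergent R b n.
Proof. by elim: n b => [|n IH] b //=; rewrite addr_ge0 // invr_ge0. Qed.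

Lemma convergent_ge1 (R : realType) (b : nat -> nat) n :
  (0 < b 0)%N -> 1 <= convergent R b n.
Proof.
move=> b0; have b1 : 1 <= (b 0%N)%:R :> R by rewrite ler1n.
case: n => [|n] //=; have := convergent_ge0 R (fun k => b k.+1) n.
by rewrite -invr_ge0; lra.
Qed.

(** For [c, p, q >= 1] the denominator is at least [4]: two steps of the continued
    fraction map contract distances. Read backwards, they expand them. *)
Lemma inv_addV_sub (R : realType) (c p q : R) : 0 < c -> 0 < p -> 0 < q ->
  (c + p^-1)^-1 - (c + q^-1)^-1 = (p - q) / ((c * p + 1) * (c * q + 1)).
Proof.
move=> c0 p0 q0; have cp := mulr_gt0 c0 p0; have cq := mulr_gt0 c0 q0.
field; apply/and4P; split; try lra.
Qed.

(** The convergents form a Cauchy sequence: those of index at least [2 * k] lie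
    within [2 ^ (- k)] of each other, whatever the positive digits are. *)
Lemma convergent_contract (R : realType) (b : nat -> nat) k m n :
  (forall i, (0 < b i)%N) ->
  `|convergent R b (k.*2 + m) - convergent R b (k.*2 + n)| * 2 ^+ k <= 1.
Proof.
elim: k b => [|k IH] b b_gt0.
  have bnd j : (b 0)%:R <= convergent R b j <= (b 0)%:R + 1.
    case: j => [|j] /=; first by apply/andP; split; lra.
    have C1 := @convergent_ge1 R (fun k => b k.+1) j (b_gt0 1%N).
    rewrite lerDl invr_ge0 lerD2l invf_le1; last by lra.
    by rewrite C1 andbT; lra.
  rewrite expr0 mulr1 ler_norml.
  by have := bnd (0.*2 + m)%N; have := bnd (0.*2 + n)%N; lra.
rewrite doubleS !addSn /= opprD addrACA subrr add0r.
set P := convergent _ _ _; set Q := convergent _ _ _.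
have P1 : 1 <= P by apply: convergent_ge1.
have Q1 : 1 <= Q by apply: convergent_ge1.
have c1 : 1 <= (b 1%N)%:R :> R by rewrite ler1n.
have {}IH : `|P - Q| * 2 ^+ k <= 1 by exact: (IH _ (fun i => b_gt0 i.+2)).
rewrite inv_addV_sub ?normrM; try lra.
set T := ((_ + 1) * _).
have cP : 1 <= (b 1%N)%:R * P by nra.
have cQ : 1 <= (b 1%N)%:R * Q by nra.
have T2 : 2 <= T by rewrite /T; nra.
rewrite normfV [X in _ / X]ger0_norm; last lra.
apply: le_trans IH; rewrite exprS mulrAC ler_pdivrMr; last lra.
have := normr_ge0 (P - Q); have : 0 <= 2 ^+ k :> R by rewrite exprn_ge0.
set N := `|_|; move: (2 ^+ k) => K K0 N0; have := mulr_ge0 K0 N0; nra.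
Qed.

Lemma convergent_cvg (R : realType) (b : nat -> nat) :
  (forall i, (0 < b i)%N) -> cvg (convergent R b n @[n --> \oo]).
Proof.
move=> b_gt0; apply: cauchy_cvg; apply: cauchy_exP => e e0.
have [k ek] := pow2_unbounded e^-1.
exists (convergent R b (k.*2 + 0)).
suff : \forall n \near \oo,
  ball (convergent R b (k.*2 + 0)) e (convergent R b n) by [].
near=> n.
have -> : n = (k.*2 + (n - k.*2))%N.
  by rewrite subnKC //; near: n; exact: nbhs_infty_ge.
rewrite /= /ball_.
have := convergent_contract R k 0 (n - k.*2) b_gt0.
rewrite -ler_pdivlMr ?exprn_gt0// => /le_lt_trans; apply.
by rewrite mul1r invf_plt ?posrE ?exprn_gt0.
Unshelve. all: by end_near. Qed.

Lemma cfrac_ge1 (R : realType) (b : nat -> nat) :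
  (forall i, (0 < b i)%N) -> 1 <= cfrac R b.
Proof.
move=> b_gt0; apply: limr_ge; first exact: convergent_cvg.
by near=> n; apply: convergent_ge1.
Unshelve. all: by end_near. Qed.

Lemma cfrac_rec (R : realType) (b : nat -> nat) :
  (forall i, (0 < b i.+1)%N) ->
  cfrac R b = (b 0%N)%:R + (cfrac R (fun k => b k.+1))^-1.
Proof.
move=> b_gt0; have C1 := @cfrac_ge1 R (fun k => b k.+1) b_gt0.
apply/cvg_lim => //; rewrite -cvg_shiftS /=.
apply: cvgD; first exact: cvg_cst.
apply: cvgV; first by rewrite gt_eqF //; lra.
exact: convergent_cvg.
Qed.


(** * Complete quotients of a two-sided sequence *)

Lemma cf_leftE (R : realType) (A : int -> nat) i :
  (forall i, (0 < A i)%N) ->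
  cf_left R A i = (cfrac R (fun k : nat => A (i - 1 - k%:Z)))^-1.
Proof.
move=> A_gt0; rewrite /cf_left cfrac_rec //= add0r; congr (cfrac R _)^-1.
by apply/funext => k; congr A; lia.
Qed.

(** The part of continued fraction theory on which the comparison of dispersions
    rests: both one-sided expansions satisfy one-step recursions in opposite
    directions. *)
Definition cf_pair (R : realType) (A : int -> nat) (x y : int -> R) : Prop :=
  forall i : int, [/\ 1 < x i, 0 < y i < 1,
    x i = (A i)%:R + (x (i + 1))^-1 & y (i + 1) = ((A i)%:R + y i)^-1].

Lemma cf_pairP (R : realType) (A : int -> nat) :
  (forall i, (0 < A i)%N) -> cf_pair A (cf_right R A) (cf_left R A).
Proof.
move=> A_gt0.
have A1 i : 1 <= (A i)%:R :> R by rewrite ler1n.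
have recx i : cf_right R A i = (A i)%:R + (cf_right R A (i + 1))^-1.
  rewrite {1}/cf_right cfrac_rec // addr0; congr (_ + (cfrac R _)^-1).
  by apply/funext => k; congr A; lia.
have recy i : cf_left R A (i + 1) = ((A i)%:R + cf_left R A i)^-1.
  rewrite !cf_leftE // cfrac_rec //; congr (((A _)%:R + (cfrac R _)^-1)^-1).
    lia.
  by apply/funext => k; congr A; lia.
have x1 i : 1 <= cf_right R A i by apply: cfrac_ge1.
have y0 i : 0 < cf_left R A i.
  by rewrite cf_leftE // invr_gt0 (lt_le_trans ltr01) ?cfrac_ge1.
move=> i; split=> //.
- rewrite recx; have : 0 < (cf_right R A (i + 1))^-1.
    by rewrite invr_gt0 (lt_le_trans ltr01).
  by have := A1 i; lra.
- rewrite y0 /= -[i](subrK 1) recy.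
  by rewrite invf_lt1; have := y0 (i - 1); have := A1 (i - 1); lra.
Qed.

(** Each step of the algorithm rescales abscissas by a complete quotient, so two
    steps rescale them by a factor of at least two. *)
Lemma cf_pair_mul_ge2 (R : realType) A (x y : int -> R) i :
  cf_pair A x y -> (0 < A i)%N -> 2 <= x i * x (i + 1).
Proof.
move=> xyP A_gt0; have [_ _ -> _] := xyP i; have [x1 _ _ _] := xyP (i + 1).
have A1 : 1 <= (A i)%:R :> R by rewrite ler1n.
rewrite mulrDl mulVf; last by rewrite gt_eqF //; lra.
have : 1 * 1 <= (A i)%:R * x (i + 1) by apply: ler_pM; lra.
lra.
Qed.

(** [X] stands for [a, 1, a, 1, ...], the largest value with digits in [[1, a]]. A
    value above [X] forces the value two digits later to exceed [X] at least
    twice as much; this cannot go on, because all [x k] are at most [a + 1]. *)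
Lemma cf_value_le_alt (R : realType) (a : nat) (X : R) (b : nat -> nat) (x : nat -> R) :
  1 <= X -> X = a%:R + (1 + X^-1)^-1 ->
  (forall k, (0 < b k <= a)%N) ->
  (forall k, 1 <= x k /\ x k = (b k)%:R + (x k.+1)^-1) ->
  x 0%N <= X.
Proof.
move=> X1 eqX b_bnd xP; rewrite leNgt; apply/negP => gtX.
have b1 k : 1 <= (b k)%:R :> R by rewrite ler1n; case/andP: (b_bnd k).
have ba k : (b k)%:R <= a%:R :> R by rewrite ler_nat; case/andP: (b_bnd k).
have step k : 2 * (x k - X) <= x k.+2 - X \/ x k <= X.
  have [lekX|gtkX] := leP (x k) X; [by right | left].
  have [xk1 xkE] := xP k; have [xk2 xk1E] := xP k.+1; have [x31 _] := xP k.+2.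
  have : x k <= a%:R + (1 + (x k.+2)^-1)^-1.
    rewrite xkE xk1E lerD // lef_pV2 ?posrE ?lerD2r //;
      have : 0 < (x k.+2)^-1 by [rewrite invr_gt0; lra].
    by have := b1 k.+1; lra.
    by lra.
  move: (x k) (x k.+2) gtkX x31 xk1 {xkE xk1E} => p q Xp q1 p1 le_p.
  have := @inv_addV_sub R 1 q X ltr01 ltac:(lra) ltac:(lra).
  rewrite !mul1r => E.
  have {le_p E} : p - X <= (q - X) / ((q + 1) * (X + 1)) by lra.
  rewrite ler_pdivlMr; last nra.
  have : 4 <= (q + 1) * (X + 1) by nra.
  move: (_ * _) => T T4; nra.
have grow n : 2 ^+ n * (x 0%N - X) <= x n.*2 - X.
  elim: n => [|n IH]; first by rewrite expr0 mul1r.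
  have p0 : 0 < 2 ^+ n * (x 0%N - X) by rewrite mulr_gt0 ?exprn_gt0//; lra.
  by rewrite exprS doubleS -mulrA; case: (step n.*2) => ?; lra.
have [n ltn] := pow2_unbounded ((a%:R + 1) / (x 0%N - X)).
have := grow n; rewrite ltr_pdivrMr in ltn; last lra.
have [x2 x2E] := xP n.*2; have [x21 _] := xP n.*2.+1.
have : (x n.*2.+1)^-1 <= 1 by rewrite invf_le1; lra.
have := ba n.*2; lra.
Qed.

Lemma cf_pair_le_alt (R : realType) (A : int -> nat) (x y : int -> R)
    (a : nat) (X : R) i :
  cf_pair A x y -> (forall i, (0 < A i <= a)%N) ->
  1 <= X -> X = a%:R + (1 + X^-1)^-1 ->
  (x (i + 1))^-1 <= (1 + X^-1)^-1 /\ y i <= (1 + X^-1)^-1.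
Proof.
move=> xyP A_bnd X1 eqX.
have X0 : 0 < X^-1 by rewrite invr_gt0; lra.
have bndV (c t : R) : 1 <= c -> 0 < t <= X -> (c + t^-1)^-1 <= (1 + X^-1)^-1.
  move=> c1 /andP[t0 tX]; have t1 : X^-1 <= t^-1 by rewrite lef_pV2 ?posrE //; lra.
  by rewrite lef_pV2 ?posrE; lra.
have A1 k : 1 <= (A k)%:R :> R by rewrite ler1n; case/andP: (A_bnd k).
split.
  have [_ _ -> _] := xyP (i + 1); apply: bndV => //.
  have [x1 _ _ _] := xyP (i + 1 + 1); apply/andP; split; first lra.
  have := @cf_value_le_alt R a X (fun k => A (i + 1 + 1 + k%:Z))
    (fun k => x (i + 1 + 1 + k%:Z)).
  rewrite addr0; apply=> // k; have [xk _ E _] := xyP (i + 1 + 1 + k%:Z).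
  split; first exact: ltW.
  by rewrite E; congr (_ + (x _)^-1); lia.
have -> : i = i - 2 + 1 + 1 :> int by lia.
have [_ _ _ ->] := xyP (i - 2 + 1); have [_ _ _ ->] := xyP (i - 2).
pose z k := (A (i - 2 - k%:Z))%:R + y (i - 2 - k%:Z).
have z1 k : 1 <= z k.
  have [_ /andP[y0 _] _ _] := xyP (i - 2 - k%:Z).
  by have := A1 (i - 2 - k%:Z); rewrite /z; lra.
have := z1 0%N; rewrite /z subr0 => z01.
apply: bndV => //; apply/andP; split; first lra.
suff : z 0%N <= X by rewrite /z subr0.
apply: (@cf_value_le_alt R a X (fun k => A (i - 2 - k%:Z))) => // k; split=> //.
have [_ _ _ E] := xyP (i - 2 - k.+1%:Z); rewrite /z -E.
by congr (_ + y _); lia.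
Qed.

(** The alternating sequence is symmetric about the index [0], so its two tails
    there have the same value. *)
Lemma alt_seq_cf (R : realType) (a : nat) (X := cf_right R (alt_seq a 1) 0) :
  (0 < a)%N ->
  [/\ 1 <= X, X = a%:R + (1 + X^-1)^-1
    & cf_left R (alt_seq a 1) 0 = (1 + X^-1)^-1].
Proof.
move=> a_gt0.
have alt_gt0 i : (0 < alt_seq a 1 i)%N by rewrite /alt_seq; case: ifP.
have P := cf_pairP R alt_gt0.
have [X1 _ E0 _] := P 0; have [_ _ E1 _] := P (0 + 1).
have E2 : cf_right R (alt_seq a 1) (0 + 1 + 1) = X.
  congr (cfrac R _); apply/funext => k; rewrite /alt_seq add0r.
  by rewrite (_ : 0 + 1 + 1 + k%:Z = k.+2%:Z) ?absz_nat /= ?negbK //; lia.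
split; first exact: ltW.
  by rewrite {1}/X E0 E1 E2.
rewrite cf_leftE // -E2 -[1]/((alt_seq a 1 (0 + 1))%:R) -E1; congr (cfrac R _)^-1.
apply/funext => k; rewrite /alt_seq; congr (if odd _ then _ else _).
by rewrite (_ : 0 - 1 - k%:Z = - (0 + 1 + k%:Z)) ?abszN //; lia.
Qed.

Lemma const_seq_cf (R : realType) (a : nat) (X := cf_right R (const_seq a) 0) i :
  (0 < a)%N ->
  [/\ 1 < X, X = a%:R + X^-1, cf_right R (const_seq a) i = X
    & cf_left R (const_seq a) i = X^-1].
Proof.
move=> a_gt0.
have P := @cf_pairP R (const_seq a) (fun=> a_gt0).
have [X1 _ E0 _] := P 0; split=> //.
by rewrite cf_leftE.
Qed.

(** * The normalised area of an empty box *)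

(** Normalised area of the maximal empty box attached to a lattice basis
    [(1, 1)], [(- u, v)]. It equals [1 + (u * v + 1) / (u + v)]. *)
Definition box_ratio (R : realType) (u v : R) : R := (1 + u) * (1 + v) / (u + v).

Lemma box_ratioC (R : realType) (u v : R) : box_ratio u v = box_ratio v u.
Proof. by rewrite /box_ratio [(1 + u) * _]mulrC [u + v]addrC. Qed.

Lemma box_ratio_le (R : realType) (u v u' v' : R) : 0 < u + v -> 0 < u' + v' ->
  (box_ratio u v <= box_ratio u' v') =
  ((u * v + 1) * (u' + v') <= (u' * v' + 1) * (u + v)).
Proof.
move=> s0 s'0; rewrite /box_ratio ler_pdivrMr // mulrAC ler_pdivlMr //.
by apply/idP/idP => h; lra.
Qed.

(** The partial derivative in [u] has the sign of [v ^ 2 - 1]. *)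
Lemma box_ratio_mono (R : realType) (u v u' v' : R) :
  1 <= u <= u' -> 1 <= v <= v' -> box_ratio u v <= box_ratio u' v'.
Proof.
have mono (p p' q : R) : 1 <= p <= p' -> 1 <= q -> box_ratio p q <= box_ratio p' q.
  move=> /andP[p1 pp'] q1; rewrite box_ratio_le; try lra.
  have : 0 <= (p' - p) * ((q - 1) * (q + 1)) by rewrite !mulr_ge0 //; lra.
  lra.
move=> /[dup] /andP[u1 uu'] hu /[dup] /andP[v1 vv'] hv.
apply: le_trans (mono u u' v hu v1) _.
rewrite ![box_ratio u' _]box_ratioC; apply: mono => //; lra.
Qed.

(** The value is [2] when [u = 1] or [v = 1], and its difference to [2] has the sign
    of [(u - 1) * (v - 1)]. *)
Lemma box_ratio_le2 (R : realType) (u v : R) : 1 <= u -> 0 < v <= 1 -> box_ratio u v <= 2.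
Proof.
move=> u1 /andP[v0 v1]; rewrite /box_ratio ler_pdivrMr; last lra.
have : 0 <= (u - 1) * (1 - v) by rewrite mulr_ge0 //; lra.
lra.
Qed.

Lemma box_ratio_ge2 (R : realType) (u v : R) : 1 <= u -> 1 <= v -> 2 <= box_ratio u v.
Proof.
move=> u1 v1; rewrite /box_ratio ler_pdivlMr; last lra.
have : 0 <= (u - 1) * (v - 1) by rewrite mulr_ge0 //; lra.
lra.
Qed.

(** The larger argument loses [d] and the smaller one gains [e]. Exactly, the
    ratio does not decrease iff
    [e * d * (w1 + w2) <= e * (w1 ^ 2 - 1) - d * (w2 ^ 2 - 1)]; replacing [w2] by
    [w1] in the last term gives a condition in which [w1] and [w2] enter only
    through [w1 ^ 2 - 1] and the constant sum. *)
Lemma box_ratio_perturb (R : realType) (w1 w2 d e : R) :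
  1 < w2 <= w1 -> 0 < d < 1 -> 0 < e ->
  e * d * (w1 + w2) <= (e - d) * (w1 ^+ 2 - 1) ->
  box_ratio w1 w2 <= box_ratio (w1 - d) (w2 + e).
Proof.
move=> /andP[w21 w12] /andP[d0 d1] e0 le_m; rewrite box_ratio_le; try lra.
have : 0 <= d * ((w1 - w2) * (w1 + w2)) by rewrite !mulr_ge0 //; lra.
move: le_m; rewrite expr2; nra.
Qed.

(** Here [t = [0, a, a, ...]], the tail on the right is [t - d] and the one on
    the left [t + e]. One step further the right tail is [(t - d)^-1 - a], above [t] by
    [al * d / (t - d)], and the left one is [(al + e)^-1], below [t] by
    [t * e / (al + e)]. If the criterion of [box_ratio_perturb] fails before the
    step, [d] is so large compared with [e] that it holds after the step. *)
Lemma box_ratio_perturb_twice (R : realType) (t al a w1 w2 d e : R) :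
  0 < t < 1 -> al = t^-1 -> al = a + t -> 2 <= a ->
  w1 + w2 = al + t -> 1 < w2 <= w1 ->
  0 < d < t -> 0 < e < 1 ->
  box_ratio w1 w2 <= box_ratio (w1 - d) (w2 + e) \/
  box_ratio w1 w2 <= box_ratio (w2 + ((t - d)^-1 - al)) (w1 - (t - (al + e)^-1)).
Proof.
move=> /andP[t0 t1] alV al_a a2 sw hw /andP[d0 dt] /andP[e0 e1].
have /andP[w21 w12] := hw.
have alt : al * t = 1 by rewrite alV mulVf //; lra.
have [le1|gt1] := leP (e * d * (w1 + w2)) ((e - d) * (w1 ^+ 2 - 1)).
  by left; apply: box_ratio_perturb => //; lra.
right; rewrite [leRHS]box_ratioC.
have eE : (t - d)^-1 - al = al * d / (t - d).
  by rewrite alV; field; apply/andP; split; lra.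
have dE : t - (al + e)^-1 = t * e / (al + e).
  have -> : t = al^-1 by rewrite alV invrK.
  by field; apply/andP; split; lra.
rewrite eE dE.
have e1_gt0 : 0 < al * d / (t - d) by rewrite divr_gt0 ?mulr_gt0 //; lra.
have d1_gt0 : 0 < t * e / (al + e) by rewrite divr_gt0 ?mulr_gt0 //; lra.
apply: box_ratio_perturb => //.
  rewrite d1_gt0 /= ltr_pdivrMr; last lra.
  have : t * e < 1 * 1 by apply: ltr_pM; lra.
  lra.
set m := w1 ^+ 2 - 1 in gt1 *.
(* w1 is at least the mean (al + t) / 2, whose square is a ^ 2 / 4 + 1. *)
have m1 : 1 <= m.
  by rewrite /m expr2; nra.
rewrite -subr_ge0.
have -> : (al * d / (t - d) - t * e / (al + e)) * m -
    al * d / (t - d) * (t * e / (al + e)) * (w1 + w2) =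
   ((al * d * (al + e) - t * e * (t - d)) * m -
     (al * t) * (d * e) * (w1 + w2)) / ((t - d) * (al + e)).
  by field; apply/andP; split; lra.
rewrite divr_ge0 //; last by apply: mulr_ge0; lra.
rewrite alt mul1r sw.
rewrite sw in gt1.
have /andP[t20 t21] : 0 <= t * t <= 1 by apply/andP; split; nra.
(* Eliminating the product (e - d) * m by the failed criterion, multiplied by
   t * t, leaves an inequality divisible by d and by al + t. *)
have key : 0 <= d * (((al * al - t * t) + (al + t) * e) * m - (1 + t * t) * e * (al + t)).
  apply: mulr_ge0; first lra.
  have -> : al * al - t * t = a * (al + t) by rewrite [a](_ : _ = al - t); [ring | lra].
  have s0 : 0 < al + t by lra.
  have -> : (a * (al + t) + (al + t) * e) * m - (1 + t * t) * e * (al + t) =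
     (al + t) * ((a + e) * m - (1 + t * t) * e) by ring.
  apply: mulr_ge0; first lra.
  have : (1 + t * t) * e <= 2 * 1 by apply: ler_pM; lra.
  have : 2 * 1 <= (a + e) * m by apply: ler_pM; lra.
  lra.
have : 0 <= t * t * (e * d * (al + t) - (e - d) * m).
  by rewrite mulr_ge0 // subr_ge0 ltW.
lra.
Qed.

(** A tail [s] below [0, a, a, ...] must start with the largest digit [a], and the
    tail after that digit is above [0, a, a, ...]. *)
Lemma inv_forces_max_digit (R : realType) (a n : nat) (al s s' : R) :
  0 < s < 1 -> 0 < s' < 1 -> al = a%:R + al^-1 -> 1 < al -> s < al^-1 ->
  (n <= a)%N -> s^-1 = n%:R + s' -> n = a /\ al^-1 < s'.
Proof.
move=> /andP[s0 s1] /andP[s'0 s'1] alE al1 sal na sE.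
have lt_al : al < s^-1 by rewrite -[al]invrK ltf_pV2 ?posrE // invr_gt0; lra.
have al0 : 0 < al^-1 by rewrite invr_gt0; lra.
have an : a = n.
  apply/eqP; rewrite eqn_leq na andbT -ltnS -(ltr_nat R) -natr1; lra.
by split=> //; move: lt_al; rewrite sE -an; lra.
Qed.

(** For [j = 0] the ratio is at most [2] and the index [1] does better; by
    symmetry of the constant sequence one may then take [j <= a - j]. The larger
    argument [w1] has to go with the tail that is too small. When that is the
    right tail at [i], it is the left one at [i + 1], which is why the witness
    there is [a - j]. *)
Lemma const_ratio_le_some (R : realType) (A : int -> nat) (x y : int -> R) (a : nat)
    (al : R) (j : nat) :
  cf_pair A x y -> (forall i, (A i <= a)%N) -> (exists i, A i = a) ->
  (1 < a)%N -> 1 < al -> al = a%:R + al^-1 -> (j < a)%N ->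
  exists i j', (j' <= A i)%N /\
    box_ratio (al - j%:R) (al^-1 + j%:R) <= box_ratio (x i - j'%:R) (y i + j'%:R).
Proof.
move=> xyP A_le [i0 Ai0] a_gt1 al1 alE.
have a2 : 2 <= a%:R :> R by rewrite ler_nat.
set t := al^-1 in alE *.
have t0 : 0 < t by rewrite invr_gt0; lra.
have t1 : t < 1 by rewrite invf_lt1; lra.
have alV : al = t^-1 by rewrite /t invrK.
wlog j_gt0 : j / (0 < j)%N.
  move=> main; case: j => [_|j ltja]; last exact: main.
  have [i [j' [j'_le le']]] := main 1%N isT a_gt1.
  exists i, j'; split=> //; apply: le_trans le'.
  rewrite subr0 addr0; apply: le_trans (box_ratio_ge2 _ _); last 2 first.
  - by lra.
  - by lra.
  by apply: box_ratio_le2; lra.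
wlog le_j : j j_gt0 / (j <= a - j)%N.
  move=> main ltja; have [le_j|gt_j] := leqP j (a - j); first exact: main.
  have [|||i [j' [j'_le le']]] := main (a - j)%N; try lia.
  exists i, j'; split=> //; apply: le_trans le'.
  rewrite natrB ?(ltnW ltja) // [leRHS]box_ratioC.
  by rewrite le_eqVlt; apply/orP; left; apply/eqP; congr box_ratio; lra.
move=> ltja.
pose w1 : R := (a - j)%:R + t; pose w2 : R := j%:R + t.
have natB : (a - j)%:R = a%:R - j%:R :> R by rewrite natrB // ltnW.
have j1 : 1 <= j%:R :> R by rewrite ler1n.
have jR : j%:R <= (a - j)%:R :> R by rewrite ler_nat.
have -> : box_ratio (al - j%:R) (t + j%:R) = box_ratio w1 w2.
  by rewrite /w1 /w2 natB; congr box_ratio; lra.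
have big i : A i = a -> t <= (x (i + 1))^-1 -> t <= y i ->
    exists i j', (j' <= A i)%N /\
      box_ratio w1 w2 <= box_ratio (x i - j'%:R) (y i + j'%:R).
  move=> Ai tx ty; exists i, j; rewrite Ai; split; first exact: ltnW.
  have [_ _ -> _] := xyP i; rewrite Ai.
  by apply: box_ratio_mono; rewrite /w1 /w2 ?natB; lra.
have xV i : 0 < (x i)^-1 < 1.
  by have [x1 _ _ _] := xyP i; rewrite invr_gt0 invf_lt1; lra.
have nextx i : (x (i + 1))^-1 < t -> A (i + 1) = a /\ t < (x (i + 1 + 1))^-1.
  move=> lt_t; apply: (@inv_forces_max_digit R a (A (i + 1)) al (x (i + 1))^-1) => //.
  by rewrite invrK; have [_ _ -> _] := xyP (i + 1).
have prevy i : y (i + 1) < t -> A i = a /\ t < y i.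
  move=> lt_t; have [_ yi1 _ _] := xyP (i + 1); have [_ yi _ yE] := xyP i.
  apply: (@inv_forces_max_digit R a (A i) al (y (i + 1))) => //.
  by rewrite yE invrK.
have mixed i : A i = a -> (x (i + 1))^-1 < t -> t < y i ->
    exists i j', (j' <= A i)%N /\
      box_ratio w1 w2 <= box_ratio (x i - j'%:R) (y i + j'%:R).
  move=> Ai xlt ylt; have [Ai1 xgt] := nextx i xlt.
  have [_ yi xiE yE] := xyP i; have [_ _ xi1E _] := xyP (i + 1).
  have /andP[sx0 _] := xV (i + 1).
  have [|||||||||] := @box_ratio_perturb_twice R t al a%:R w1 w2
    (t - (x (i + 1))^-1) (y i - t);
    rewrite /w1 /w2 ?natB; try lra.
  - move=> le1; exists i, j; rewrite Ai; split; first exact: ltnW.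
    apply: le_trans le1 _; rewrite xiE Ai le_eqVlt; apply/orP; left; apply/eqP.
    by congr box_ratio; lra.
  move=> le1; exists (i + 1), (a - j)%N; rewrite Ai1; split; first exact: leq_subr.
  rewrite subKr invrK (_ : al + (y i - t) = a%:R + y i) in le1; last by lra.
  apply: le_trans le1 _; rewrite yE Ai natB le_eqVlt; apply/orP; left; apply/eqP.
  by congr box_ratio; lra.
have [tx|tx] := leP t (x (i0 + 1))^-1.
  have [ty|ty] := leP t (y i0); first exact: big Ai0 tx ty.
  have [_ _ x0E _] := xyP i0.
  have yi0 : y (i0 - 1 + 1) < t by rewrite subrK.
  have [Aim tym] := prevy _ yi0.
  have : (x (i0 - 1 + 1))^-1 <= t.
    rewrite subrK lef_pV2 ?posrE; first by rewrite x0E Ai0; lra.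
      by have [? _ _ _] := xyP i0; lra.
    lra.
  rewrite le_eqVlt => /orP[/eqP xt|xlt]; last exact: mixed Aim xlt tym.
  by apply: (big (i0 - 1)) => //; [rewrite xt | exact: ltW].
have [Ai1 xgt] := nextx _ tx.
have [ty|ty] := ltP t (y i0); first exact: mixed Ai0 tx ty.
apply: (big (i0 + 1)) => //; first exact: ltW.
have [_ y0 _ yE] := xyP i0; rewrite yE Ai0 /t lef_pV2 ?posrE; lra.
Qed.

(** [X] is [a, 1, a, 1, ...] and [(1 + X^-1)^-1] is [0, 1, a, 1, a, ...]. *)
Lemma ratio_le_alt_ratio (R : realType) (A : int -> nat) (x y : int -> R) (a : nat)
    (X : R) i (j : nat) :
  cf_pair A x y -> (forall i, (0 < A i <= a)%N) -> (1 < a)%N ->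
  1 <= X -> X = a%:R + (1 + X^-1)^-1 -> (j < A i)%N ->
  exists j', (j' < a)%N /\
    box_ratio (x i - j%:R) (y i + j%:R) <= box_ratio (X - j'%:R) ((1 + X^-1)^-1 + j'%:R).
Proof.
move=> xyP A_bnd a_gt1 X1 eqX j_lt.
have [xle yle] := cf_pair_le_alt i xyP A_bnd X1 eqX.
have [xi1 /andP[yi0 yi1] xE _] := xyP i; have [xi'1 _ _ _] := xyP (i + 1).
have xV0 : 0 < (x (i + 1))^-1 by rewrite invr_gt0; lra.
have A_le : (A i <= a)%N by case/andP: (A_bnd i).
have AR : (A i)%:R <= a%:R :> R by rewrite ler_nat.
have a2 : 2 <= a%:R :> R by rewrite ler_nat.
have jA : j%:R + 1 <= (A i)%:R :> R by rewrite natr1 ler_nat.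
move: (1 + X^-1)^-1 eqX xle yle => be eqX xle yle.
case: j j_lt jA => [|j] j_lt jA.
  exists 1%N; split=> //; apply: (@le_trans _ _ 2).
    by apply: box_ratio_le2; lra.
  by apply: box_ratio_ge2; lra.
exists j.+1; split; first exact: leq_trans A_le.
have j1 : 1 <= j.+1%:R :> R by rewrite ler1n.
by apply: box_ratio_mono; lra.
Qed.

(** * Bases and covolume *)

Lemma lattice_genP (R : realType) (p q r w : R) (z : R * R) :
  lattice_gen (p, q) (r, w) z <->
  exists m n : int, z = (m%:~R * p + n%:~R * r, m%:~R * q + n%:~R * w).
Proof.
have E (m n : int) : (p, q) *~ m + (r, w) *~ n =
    (m%:~R * p + n%:~R * r, m%:~R * q + n%:~R * w).
  by rewrite [LHS]surjective_pairing !raddfD !raddfMz /= !mulrzl.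
by split=> -[m [n ->]]; exists m, n; rewrite E.
Qed.

Lemma lattice_gen_shear (R : realType) (u v : R * R) (k : int) :
  lattice_gen u v = lattice_gen u (v + u *~ k).
Proof.
apply/seteqP; split=> z [m [n ->]].
  exists (m - n * k), n.
  by rewrite mulrzDl mulrzBr -mulrzA [k * n]mulrC addrACA addNr addr0.
exists (m + n * k), n.
by rewrite mulrzDl mulrzDr -mulrzA [k * n]mulrC -addrA [_ + v *~ n]addrC.
Qed.

Lemma lattice_genC (R : realType) (u v : R * R) :
  lattice_gen u v = lattice_gen v u.
Proof.
by apply/seteqP; split=> z [m [n ->]]; exists n, m; rewrite addrC.
Qed.

(** Two bases of a lattice are related by integer matrices, in both directions;
    this is what makes the covolume well defined. *)
Lemma det2_lattice (R : realType) (u v u' v' : R * R) :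
  lattice_gen u v u' -> lattice_gen u v v' ->
  exists k : int, det2 u' v' = k%:~R * det2 u v.
Proof.
case: u v => [p q] [r w] /lattice_genP[m [n ->]] /lattice_genP[m' [n' ->]].
exists (m * n' - n * m'); rewrite /det2 /= intrB !intrM; ring.
Qed.

Lemma covolume_gen (R : realType) (u v : R * R) : det2 u v != 0 ->
  covolume (lattice_gen u v) = `|det2 u v|.
Proof.
move=> d0; apply: xget_unique; first by exists u, v.
move=> _ [u' [v' [d'0 eqL ->]]].
have memu (a b : R * R) : lattice_gen a b a by exists 1, 0; rewrite mulr0z addr0.
have memv (a b : R * R) : lattice_gen a b b by exists 0, 1; rewrite mulr0z add0r.
have [k kE] : exists k : int, det2 u' v' = k%:~R * det2 u v.
  by apply: det2_lattice; rewrite eqL.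
have [l lE] : exists l : int, det2 u v = l%:~R * det2 u' v'.
  by apply: det2_lattice; rewrite -eqL.
have kl1 : k * l = 1.
  apply: (@intr_inj R); apply: (mulIf d0).
  by rewrite [1%:~R * _]mul1r {2}lE kE intrM mulrA [l%:~R * _]mulrC.
have k1 : `|k|%N = 1%N.
  have : (`|k| * `|l|)%N = 1%N by rewrite -abszM kl1.
  by move/eqP; rewrite muln_eq1 => /andP[/eqP ].
by rewrite kE normrM -intr_norm -abszE k1 mul1r.
Qed.

(** * Empty boxes *)

(** The basis vectors met below have coordinates of either sign; this lemma
    reduces every box to the case [s = 1] without a case analysis. *)
Lemma scale_itv (R : realType) (s c d : R) : s != 0 ->
  exists x1 x2, x2 - x1 = `|s| * (d - c) /\
    forall a, (x1 < s * a < x2) = (c < a < d).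
Proof.
rewrite neq_lt => /orP[s0|s0].
  exists (s * d), (s * c); split; first by rewrite ltr0_norm //; ring.
  by move=> a; rewrite !ltr_nM2l // andbC.
exists (s * c), (s * d); split; first by rewrite gtr0_norm //; ring.
by move=> a; rewrite !ltr_pM2l.
Qed.

(** For [s = t = 1] the box is the product of the intervals from [- u] to [1] and
    from [0] to [1 + v]: its sides carry the points [(0, 0)], [(1, 1)], [(- u, v)] and
    [(1 - u, 1 + v)]. *)
Lemma empty_box (R : realType) (s t u v : R) :
  s != 0 -> t != 0 -> 0 < u -> 0 < v ->
  exists x1 x2 y1 y2, [/\ x1 < x2, y1 < y2,
    open_box x1 x2 y1 y2 `&` lattice_gen (s, t) (- u * s, v * t) = set0
    & (x2 - x1) * (y2 - y1) = `|s * t| * ((1 + u) * (1 + v))].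
Proof.
move=> s0 t0 u0 v0.
have [x1 [x2 [xE xP]]] := scale_itv (- u) 1 s0.
have [y1 [y2 [yE yP]]] := scale_itv 0 (1 + v) t0.
have sgt0 : 0 < `|s| by rewrite normr_gt0.
have tgt0 : 0 < `|t| by rewrite normr_gt0.
exists x1, x2, y1, y2; split.
- by rewrite -subr_gt0 xE mulr_gt0 //; lra.
- by rewrite -subr_gt0 yE mulr_gt0 //; lra.
- rewrite -subset0 => -[z1 z2] [[/= hx hy] /lattice_genP[m [n [E1 E2]]]].
  move: hx hy; rewrite {}E1 {}E2.
  have -> : m%:~R * s + n%:~R * (- u * s) = s * (m%:~R - n%:~R * u) by ring.
  have -> : m%:~R * t + n%:~R * (v * t) = t * (m%:~R + n%:~R * v) by ring.
  rewrite xP yP => /andP[x_gt x_lt] /andP[y_gt y_lt].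
  have [n_le|n_gt] := lerP n 0.
    have nR : n%:~R <= 0 :> R by rewrite lerz0.
    have m_gt : 0 < m by rewrite -(ltr_int R); nra.
    have mR : 1 <= m%:~R :> R by rewrite ler1z -gtz0_ge1.
    nra.
  have nR : 1 <= n%:~R :> R by rewrite ler1z -gtz0_ge1.
  have m_gt : 0 < m by rewrite -(ltr_int R); nra.
  have mR : 1 <= m%:~R :> R by rewrite ler1z -gtz0_ge1.
  nra.
- by rewrite xE yE normrM; ring.
Qed.

(** Consider the lattice points with ordinate in a strip of height [1 + v]. From
    each of them, either adding [(1, 1)] or subtracting [(- u, v)] stays in the
    strip, and this moves the abscissa to the right by [1] or by [u]. So one can
    walk through the strip in steps of length at most [u], less than the
    width of the box, starting as far left as desired. *)
Lemma large_box_hits (R : realType) (u v x1 x2 y1 y2 : R) :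
  1 <= u -> 0 < v -> u < x2 - x1 -> 1 + v < y2 - y1 ->
  exists m n : int,
    x1 < m%:~R - n%:~R * u < x2 /\ y1 < m%:~R + n%:~R * v < y2.
Proof.
move=> u1 v0 ltx lty.
pose Q (X : R) := exists m n : int,
  X = m%:~R - n%:~R * u /\ y1 < m%:~R + n%:~R * v <= y1 + 1 + v.
have next X : Q X -> exists X', X + 1 <= X' <= X + u /\ Q X'.
  move=> [m [n [-> /andP[y_gt y_le]]]].
  have [le_v|gt_v] := leP (m%:~R + n%:~R * v) (y1 + v).
    exists (m%:~R - n%:~R * u + 1); split; first lra.
    by exists (m + 1), n; rewrite intrD; split; lra.
  exists (m%:~R - n%:~R * u + u); split; first lra.
  by exists m, (n - 1); rewrite intrB; split; lra.
have prev X : Q X -> exists X', X' <= X - 1 /\ Q X'.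
  move=> [m [n [-> /andP[y_gt y_le]]]].
  have [le_v|gt_v] := leP (m%:~R + n%:~R * v) (y1 + 1).
    exists (m%:~R - n%:~R * u - u); split; first lra.
    by exists m, (n + 1); rewrite intrD; split; lra.
  exists (m%:~R - n%:~R * u - 1); split; first lra.
  by exists (m - 1), n; rewrite intrB; split; lra.
have [X0 QX0] : exists X, Q X.
  exists (Num.floor y1 + 1)%:~R, (Num.floor y1 + 1), 0.
  rewrite !mul0r subr0 addr0; split=> //.
  by have := floorD1_gt y1; have := floor_le_tmp y1; rewrite !intrD; lra.
have [X1 [leX1 QX1]] : exists X, X <= x1 /\ Q X.
  have iter n : exists X, X <= X0 - n%:R /\ Q X.
    elim: n => [|n [X [leX /prev[X' [leX' QX']]]]]; first by exists X0; split=> //; lra.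
    by exists X'; split=> //; rewrite -natr1; lra.
  have [X [leX QX]] := iter (Num.truncn (X0 - x1)).+1.
  by exists X; split=> //; have := truncnS_gt (X0 - x1); lra.
suff [X [X_itv [m [n [XE Y]]]]] : exists X, x1 < X < x2 /\ Q X.
  by exists m, n; rewrite -XE; split=> //; lra.
apply: contrapT => noX.
have iter n : exists X, X1 + n%:R <= X <= x1 /\ Q X.
  elim: n => [|n [X [leX QX]]]; first by exists X1; split=> //; lra.
  have [X' [leX' QX']] := next X QX.
  exists X'; split=> //; rewrite -natr1.
  have [le1|gt1] := leP X' x1; first lra.
  by exfalso; apply: noX; exists X'; split=> //; lra.
have [X [leX _]] := iter (Num.truncn (x1 - X1)).+1.
by have := truncnS_gt (x1 - X1); lra.
Qed.

(** Contrapositive form of [large_box_hits] for a rescaled basis. *)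
Lemma empty_box_height (R : realType) (s t u v x1 x2 y1 y2 : R) :
  s != 0 -> t != 0 -> 1 <= u -> 0 < v ->
  open_box x1 x2 y1 y2 `&` lattice_gen (s, t) (- u * s, v * t) = set0 ->
  `|s| * u < x2 - x1 -> y2 - y1 <= `|t| * (1 + v).
Proof.
move=> s0 t0 u1 v0 empty ltW; rewrite leNgt; apply/negP => ltH.
have [c1 [c2 [cE cP]]] := @scale_itv R s^-1 x1 x2 ltac:(by rewrite invr_eq0).
have [d1 [d2 [dE dP]]] := @scale_itv R t^-1 y1 y2 ltac:(by rewrite invr_eq0).
have [||m [n [hx hy]]] := @large_box_hits R u v c1 c2 d1 d2 u1 v0.
- by rewrite cE normfV mulrC ltr_pdivlMr ?normr_gt0 // mulrC.
- by rewrite dE normfV mulrC ltr_pdivlMr ?normr_gt0 // mulrC.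
suff : (open_box x1 x2 y1 y2 `&` lattice_gen (s, t) (- u * s, v * t))
         (s * (m%:~R - n%:~R * u), t * (m%:~R + n%:~R * v)) by rewrite empty.
split; first by rewrite /open_box /= -cP -dP !mulKf.
by apply/lattice_genP; exists m, n; congr pair; ring.
Qed.

(** * The chain of bases given by the continued fraction *)

(** Up to the diagonal matrix with entries [s] and [t], the lattice is generated by
    [(1, 1)] and [(- x i, y i)]. The signs of [s] and [t] are left free, as [s]
    changes sign at each step. *)
Definition cf_basis (R : realType) (L : set (R * R)) (x y : int -> R)
    (i : int) (s t : R) : Prop :=
  [/\ s != 0, t != 0 & L = lattice_gen (s, t) (- x i * s, y i * t)].

Lemma pair_addMz (R : realType) (u v : R * R) (k : int) :
  v + u *~ k = (v.1 + k%:~R * u.1, v.2 + k%:~R * u.2).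
Proof. by rewrite [LHS]surjective_pairing !raddfD !raddfMz /= !mulrzl. Qed.

(** One step of the algorithm: the old second vector plus [b] times the first one
    becomes the new first vector, and the old first vector becomes the second. *)
Lemma lattice_gen_step (R : realType) (x y x' y' s t : R) (b : nat) :
  x = b%:R + x'^-1 -> y' = (b%:R + y)^-1 -> x' != 0 -> y' != 0 ->
  lattice_gen (s, t) (- x * s, y * t) =
  lattice_gen (- s / x', t / y') (- x' * (- s / x'), y' * (t / y')).
Proof.
move=> xE y'E x'0 y'0.
rewrite (lattice_gen_shear _ _ b%:Z) lattice_genC; congr lattice_gen.
  rewrite pair_addMz /= xE y'E invrK -pmulrn.
  by congr pair; ring.
by congr pair; field.
Qed.

Lemma cf_basis_next (R : realType) (L : set (R * R)) A (x y : int -> R) i s t :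
  cf_pair A x y -> cf_basis L x y i s t ->
  cf_basis L x y (i + 1) (- s / x (i + 1)) (t / y (i + 1)).
Proof.
move=> xyP [s0 t0 ->]; have [_ _ xE yE] := xyP i.
have [x1 /andP[y0 _] _ _] := xyP (i + 1).
have x'0 : x (i + 1) != 0 by rewrite gt_eqF //; lra.
have y'0 : y (i + 1) != 0 by rewrite gt_eqF //; lra.
split; first by rewrite mulf_neq0 ?oppr_eq0 ?invr_eq0.
  by rewrite mulf_neq0 ?invr_eq0.
exact: (@lattice_gen_step _ _ _ _ _ _ _ (A i)).
Qed.

Lemma cf_basis_prev (R : realType) (L : set (R * R)) A (x y : int -> R) i s t :
  cf_pair A x y -> cf_basis L x y (i + 1) s t ->
  cf_basis L x y i (- x (i + 1) * s) (y (i + 1) * t).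
Proof.
move=> xyP [s0 t0 ->]; have [_ _ xE yE] := xyP i.
have [x1 /andP[y0 _] _ _] := xyP (i + 1).
have x'0 : x (i + 1) != 0 by rewrite gt_eqF //; lra.
have y'0 : y (i + 1) != 0 by rewrite gt_eqF //; lra.
split; rewrite ?mulf_neq0 ?oppr_eq0 //.
rewrite (@lattice_gen_step R (x i) (y i) (x (i + 1)) (y (i + 1)) _ _ (A i)) //.
by congr lattice_gen; congr pair; field.
Qed.

(** Intermediate convergents: [j] counts the copies of the first vector added. *)
Lemma cf_basis_intermediate (R : realType) (L : set (R * R)) (x y : int -> R)
    i s t (j : nat) :
  cf_basis L x y i s t ->
  L = lattice_gen (s, t) (- (x i - j%:R) * s, (y i + j%:R) * t).
Proof.
move=> [_ _ ->]; rewrite (lattice_gen_shear _ _ j%:Z); congr lattice_gen.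
rewrite pair_addMz /= -pmulrn.
by congr pair; ring.
Qed.

Lemma cf_basis_covolume (R : realType) (L : set (R * R)) A (x y : int -> R) i s t :
  cf_pair A x y -> cf_basis L x y i s t ->
  covolume L = `|s * t| * (x i + y i).
Proof.
move=> xyP [s0 t0 ->]; have [x1 /andP[y0 _] _ _] := xyP i.
have dE : det2 (s, t) (- x i * s, y i * t) = s * t * (x i + y i).
  by rewrite /det2 /=; ring.
have xy0 : 0 < x i + y i by lra.
rewrite covolume_gen dE ?normrM; first by rewrite (gtr0_norm xy0).
by rewrite !mulf_neq0 // gt_eqF.
Qed.

(** Running the algorithm backwards, the width at least doubles every two steps. *)
Lemma cf_basis_wide (R : realType) (L : set (R * R)) A (x y : int -> R) i s t
    (W : R) :
  cf_pair A x y -> (forall i, (0 < A i)%N) -> cf_basis L x y i s t ->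
  exists i s t, cf_basis L x y i s t /\ W <= `|s| * (1 + x i).
Proof.
move=> xyP A_gt0 bas.
have grow n : exists i' s' t', cf_basis L x y i' s' t' /\ 2 ^+ n * `|s| <= `|s'|.
  elim: n => [|n [i' [s' [t' [bas' le_s']]]]]; first by exists i, s, t; rewrite mul1r.
  have iE : i' = i' - 2 + 1 + 1 by lia.
  rewrite iE in bas'; have bas1 := cf_basis_prev xyP bas'.
  have bas2 := cf_basis_prev xyP bas1.
  eexists _, _, _; split; first exact: bas2.
  have [x2 _ _ _] := xyP (i' - 2 + 1 + 1); have [x1 _ _ _] := xyP (i' - 2 + 1).
  have x12 := cf_pair_mul_ge2 xyP (A_gt0 (i' - 2 + 1)).
  rewrite !normrM !normrN [`|x (i' - 2 + 1)|]gtr0_norm; last lra.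
  rewrite [`|x (i' - 2 + 1 + 1)|]gtr0_norm; last lra.
  by rewrite exprS -mulrA [leRHS]mulrA; apply: ler_pM => //; rewrite mulr_ge0 ?exprn_ge0.
have [s0 t0 _] := bas; have sgt0 : 0 < `|s| by rewrite normr_gt0.
have [n ltn] := pow2_unbounded (W / `|s|).
have [i' [s' [t' [bas' le_s']]]] := grow n; exists i', s', t'; split=> //.
rewrite ltr_pdivrMr // in ltn.
have [x1 _ _ _] := xyP i'; have : 0 <= `|s'| * x i' by rewrite mulr_ge0 //; lra.
lra.
Qed.

(** The widths [|s| * (1 + x i)] of consecutive bases decrease to zero, and the
    one at [i + 1] equals the lower bound [|s| * (1 + x i - A i)]. *)
Lemma cf_basis_level (R : realType) (L : set (R * R)) A (x y : int -> R) i s t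
    (a : nat) (W : R) :
  cf_pair A x y -> (forall i, (0 < A i <= a)%N) -> cf_basis L x y i s t -> 0 < W ->
  exists i s t, cf_basis L x y i s t /\
    `|s| * (1 + x i - (A i)%:R) < W <= `|s| * (1 + x i).
Proof.
move=> xyP A_bnd bas W0.
have A_gt0 k : (0 < A k)%N by case/andP: (A_bnd k).
have [i0 [s0 [t0 [bas0 W_le]]]] := cf_basis_wide W xyP A_gt0 bas.
apply: contrapT => none.
have next i' s' t' : cf_basis L x y i' s' t' -> W <= `|s'| * (1 + x i') ->
    W <= `|- s' / x (i' + 1)| * (1 + x (i' + 1)).
  move=> bas' W_le'; rewrite leNgt; apply/negP => W_gt; apply: none.
  exists i', s', t'; split=> //; rewrite W_le' andbT; apply: le_lt_trans W_gt.
  have [_ _ -> _] := xyP i'; have [x1 _ _ _] := xyP (i' + 1).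
  rewrite normrM normrN normfV [`|x _|]gtr0_norm; last lra.
  rewrite le_eqVlt; apply/orP; left; apply/eqP; field; lra.
(* If no level fitted, W would stay below widths that tend to zero. *)
have shrink n : exists i' s' t', [/\ cf_basis L x y i' s' t',
    W <= `|s'| * (1 + x i') & 2 ^+ n * `|s'| <= `|s0|].
  elim: n => [|n [i' [s' [t' [bas' W_le' le_s']]]]].
    by exists i0, s0, t0; rewrite mul1r.
  have bas1 := cf_basis_next xyP bas'.
  have W_le1 := next _ _ _ bas' W_le'.
  have bas2 := cf_basis_next xyP bas1.
  have W_le2 := next _ _ _ bas1 W_le1.
  eexists _, _, _; split; [exact: bas2 | exact: W_le2 |].
  apply: le_trans le_s'.
  have [x2 _ _ _] := xyP (i' + 1 + 1); have [x1 _ _ _] := xyP (i' + 1).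
  have x12 := cf_pair_mul_ge2 xyP (A_gt0 (i' + 1)).
  rewrite !(normrM, normrN, normfV) [`|x (i' + 1)|]gtr0_norm; last lra.
  rewrite [`|x (i' + 1 + 1)|]gtr0_norm; last lra.
  rewrite -mulrA -invfM exprSr -mulrA ler_pM2l ?exprn_gt0 //.
  rewrite mulrA ler_pdivrMr; last lra.
  have := normr_ge0 s'; nra.
have [n ltn] := pow2_unbounded (`|s0| * (2 + a%:R) / W).
have [i' [s' [t' [_ W_le' le_s']]]] := shrink n.
have [_ _ xE _] := xyP i'; have [x1 _ _ _] := xyP (i' + 1).
have xV1 : (x (i' + 1))^-1 <= 1 by rewrite invf_le1; lra.
have Aa : (A i')%:R <= a%:R :> R by rewrite ler_nat; case/andP: (A_bnd i').
rewrite ltr_pdivrMr // in ltn.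
have p0 : 0 < 2 ^+ n :> R by rewrite exprn_gt0.
have : 2 ^+ n * W <= 2 ^+ n * (`|s'| * (2 + a%:R)).
  rewrite ler_pM2l //; apply: le_trans W_le' _.
  by rewrite ler_wpM2l //; lra.
have : 2 ^+ n * `|s'| * (2 + a%:R) <= `|s0| * (2 + a%:R).
  by rewrite ler_wpM2r // addr_ge0.
lra.
Qed.

(** The pair [(i, j)] is the one for which the width of the box lies between
    [|s| * u] and [|s| * (1 + u)], with [u = x i - j]; the first inequality bounds
    the height. *)
Lemma empty_box_area_le (R : realType) (L : set (R * R)) A (x y : int -> R) i s t
    (a : nat) (x1 x2 y1 y2 : R) :
  cf_pair A x y -> (forall i, (0 < A i <= a)%N) -> cf_basis L x y i s t ->
  x1 < x2 -> y1 < y2 -> open_box x1 x2 y1 y2 `&` L = set0 ->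
  exists i j, (j < A i)%N /\
    (x2 - x1) * (y2 - y1) <= box_ratio (x i - j%:R) (y i + j%:R) * covolume L.
Proof.
move=> xyP A_bnd bas ltx lty empty.
have W0 : 0 < x2 - x1 by lra.
have [i' [s' [t' [bas' /andP[W_gt W_le]]]]] :=
  cf_basis_level xyP A_bnd bas W0.
have A_gt0 : (0 < A i')%N by case/andP: (A_bnd i').
have AE : (A i')%:R = (A i').-1%:R + 1 :> R by rewrite natr1 prednK.
have exj : exists j, `|s'| * (x i' - j%:R) < x2 - x1.
  by exists (A i').-1; apply: le_lt_trans W_gt; rewrite ler_wpM2l // AE; lra.
(* The least j works: for j = 0 the width is bounded by the choice of the
   level, otherwise by the failure of j - 1. *)
case: (ex_minnP exj) => j W_gtj j_min.
have j_lt : (j < A i')%N.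
  rewrite -(prednK A_gt0) ltnS; apply: j_min.
  by apply: le_lt_trans W_gt; rewrite ler_wpM2l // AE; lra.
have W_lej : x2 - x1 <= `|s'| * (1 + (x i' - j%:R)).
  case: j j_min {j_lt W_gtj} => [|j] j_min; first by rewrite subr0.
  rewrite leNgt; apply/negP => W_gtj.
  suff : (j.+1 <= j)%N by rewrite ltnn.
  by apply: j_min; apply: le_lt_trans W_gtj; rewrite ler_wpM2l // -natr1; lra.
exists i', j; split=> //.
have [s0 t0 _] := bas'.
have [xi1 /andP[yi0 _] xE _] := xyP i'; have [xi'1 _ _ _] := xyP (i' + 1).
have xV0 : 0 < (x (i' + 1))^-1 by rewrite invr_gt0; lra.
have jA : j%:R + 1 <= (A i')%:R :> R by rewrite natr1 ler_nat.
have j0 : 0 <= j%:R :> R by rewrite ler0n.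
rewrite (cf_basis_intermediate j bas') in empty.
have H_le := empty_box_height s0 t0 (ltac:(lra) : 1 <= x i' - j%:R)
  (ltac:(lra) : 0 < y i' + j%:R) empty W_gtj.
rewrite (cf_basis_covolume xyP bas') /box_ratio.
rewrite (_ : x i' - j%:R + (y i' + j%:R) = x i' + y i'); last ring.
rewrite [leRHS](_ : _ =
  `|s'| * (1 + (x i' - j%:R)) * (`|t'| * (1 + (y i' + j%:R)))).
  by apply: ler_pM => //; lra.
by rewrite normrM; field; lra.
Qed.

Lemma area_le_disp_lattice (R : realType) (L : set (R * R)) A (x y : int -> R)
    i s t (j : nat) :
  cf_pair A x y -> cf_basis L x y i s t -> (j <= A i)%N ->
  ((box_ratio (x i - j%:R) (y i + j%:R) * covolume L)%:E <= disp_lattice L)%E.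
Proof.
move=> xyP bas jA; have [s0 t0 _] := bas.
have [xi1 /andP[yi0 _] xE _] := xyP i; have [xi'1 _ _ _] := xyP (i + 1).
have xV0 : 0 < (x (i + 1))^-1 by rewrite invr_gt0; lra.
have jR : j%:R <= (A i)%:R :> R by rewrite ler_nat.
have j0 : 0 <= j%:R :> R by rewrite ler0n.
have [x1 [x2 [y1 [y2 [ltx lty empty areaE]]]]] :=
  @empty_box R s t (x i - j%:R) (y i + j%:R) s0 t0 ltac:(lra) ltac:(lra).
apply: ereal_sup_ubound; exists x1, x2, y1, y2; split=> //.
  by rewrite (cf_basis_intermediate j bas).
rewrite areaE (cf_basis_covolume xyP bas) /box_ratio; congr (_%:E).
by field; lra.
Qed.

(** * Comparison of dispersions *)

Lemma disp_seq_ge (R : realType) (b : int -> nat) i j : (j < b i)%N ->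
  ((box_ratio (cf_right R b i - j%:R) (cf_left R b i + j%:R))%:E <= disp_seq R b)%E.
Proof.
move=> j_lt; apply: le_trans; last by apply: ereal_sup_ubound; exists i.
apply: le_trans (le_bigmax _ _ (Ordinal j_lt)) => /=.
rewrite opprK lee_fin le_eqVlt; apply/orP; left; apply/eqP.
by rewrite /box_ratio; congr (_ * _ / _); ring.
Qed.

Lemma disp_seq_le (R : realType) (b : int -> nat) (M : \bar R) :
  (forall i j, (j < b i)%N ->
    ((box_ratio (cf_right R b i - j%:R) (cf_left R b i + j%:R))%:E <= M)%E) ->
  (disp_seq R b <= M)%E.
Proof.
move=> le_M; apply: ge_ereal_sup => _ [i _ <-] /=.
apply: bigmax_le => [|j _]; first exact: leNye.
apply: le_trans (le_M i j (ltn_ord j)).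
rewrite opprK lee_fin le_eqVlt; apply/orP; left; apply/eqP.
by rewrite /box_ratio; congr (_ * _ / _); ring.
Qed.

Unset Implicit Arguments.

Theorem theorem4p6 (R : realType) (L : set (R * R)) (D D' : R)
    (A : int -> nat) (a : nat)
    (hL : irrational_lattice L)
    (hgen : L = lattice_gen (1, 1) (- D, - D'))
    (hD : 1 < D) (hD' : -1 < D' < 0)
    (hApos : forall i : int, (0 < A i)%N)
    (hAr : D = cf_right R A 0)
    (hAl : - D' = cf_left R A 0)
    (hmax_ub : forall i : int, (A i <= a)%N)
    (hmax_att : exists i : int, A i = a) :
  (disp_seq R (const_seq a) <= disp_lattice L * (covolume L)^-1%:E
     <= disp_seq R (alt_seq a 1))%E.
Proof.
have xyP := cf_pairP R hApos.
have A_bnd i : (0 < A i <= a)%N by rewrite hApos hmax_ub.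
have a_gt0 : (0 < a)%N by case: hmax_att => i <-.
have bas0 : cf_basis L (cf_right R A) (cf_left R A) 0 1 1.
  by split; rewrite ?oner_neq0 // !mulr1 -hAr -hAl.
have cov_gt0 : 0 < covolume L.
  rewrite (cf_basis_covolume xyP bas0).
  by have [? /andP[? _] _ _] := xyP 0; rewrite mulr1 normr1 mul1r; lra.
have bas i : exists s t, cf_basis L (cf_right R A) (cf_left R A) i s t.
  have up (n : nat) : exists s t, cf_basis L (cf_right R A) (cf_left R A) n%:Z s t.
    elim: n => [|n [s [t bas]]]; first by exists 1, 1.
    by eexists _, _; rewrite -addn1 PoszD; apply: cf_basis_next bas.
  have down (n : nat) : exists s t, cf_basis L (cf_right R A) (cf_left R A) (- n%:Z) s t.
    elim: n => [|n [s [t bas]]]; first by exists 1, 1; rewrite oppr0.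
    rewrite (_ : - n%:Z = - n.+1%:Z + 1) in bas; last by lia.
    by eexists _, _; apply: cf_basis_prev bas.
  by case: i => n; [exact: up | rewrite NegzE; exact: down].
have const1 : a = 1%N -> A = const_seq a.
  by move=> a1; apply/funext => i; apply/eqP; rewrite eqn_leq hmax_ub /const_seq a1 hApos.
have lower i j : (j <= A i)%N ->
    ((box_ratio (cf_right R A i - j%:R) (cf_left R A i + j%:R))%:E <=
      disp_lattice L * (covolume L)^-1%:E)%E.
  move=> j_le; have [s [t basi]] := bas i.
  by rewrite lee_pdivlMr // -EFinM; apply: area_le_disp_lattice xyP basi j_le.
apply/andP; split.
  apply: disp_seq_le => i j j_lt.
  have [a_le1|a_gt1] := leqP a 1.
    have AE : A = const_seq a by apply: const1; apply/eqP; rewrite eqn_leq a_le1.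
    by rewrite -AE; apply: lower; rewrite AE ltnW.
  have [al1 alE -> ->] := const_seq_cf R i a_gt0.
  have [i' [j' [j'_le le_box_ratio]]] :=
    const_ratio_le_some xyP hmax_ub hmax_att a_gt1 al1 alE j_lt.
  by apply: le_trans (lower i' j' j'_le); rewrite lee_fin.
rewrite lee_pdivrMr //; apply: ge_ereal_sup => _ [x1 [x2 [y1 [y2 [ltx lty empty ->]]]]].
have [i [j [j_lt area_le]]] := empty_box_area_le xyP A_bnd bas0 ltx lty empty.
apply: (@le_trans _ _
  (box_ratio (cf_right R A i - j%:R) (cf_left R A i + j%:R) * covolume L)%:E).
  by rewrite lee_fin.
rewrite EFinM lee_wpmul2r //; first by rewrite lee_fin ltW.
have [a_le1|a_gt1] := leqP a 1.
  have a1 : a = 1%N by apply/eqP; rewrite eqn_leq a_le1.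
  have AE : A = alt_seq a 1.
    by rewrite const1 //; apply/funext => k; rewrite /alt_seq a1 if_same.
  by rewrite -AE; apply: disp_seq_ge.
have [X1 XE YE] := alt_seq_cf R a_gt0.
have [j' [j'_lt le_box_ratio]] := ratio_le_alt_ratio xyP A_bnd a_gt1 X1 XE j_lt.
apply: (@le_trans _ _ _ _ _ _ (@disp_seq_ge R (alt_seq a 1) 0 j' j'_lt)).
by rewrite lee_fin YE.
Qed.
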